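(* For every $k\ge 0$, the simplices $\sigma_k$ and $\tau_k$ of $\mathrm{F}^+\mathrm{K}$ are critical in the restricted steepness pairing. Here $\sigma_0=\tau_0=e$, $\sigma_1=\tau_1=y$, and for $k\ge 2$ $$\sigma_k=\alpha_k^{(k)}\alpha_{k-1}^{(k)}\cdots\alpha_1^{(k)},\qquad \tau_k=\alpha_k^{(k)}\alpha_{k-1}^{(k)}\cdots\alpha_3^{(k)}\bigl(\alpha_2^{(k)}\bigr)^2 .$$
   Context: **The simplicial monoid.** Let $K$ be the simplicial set with a unique $0$-simplex $e$ and a single nondegenerate $1$-simplex $y$, all other simplices being iterated degeneracies of these (so $|K|\cong S^1$). For $n\ge 0$ let $\mathrm{F}^+\mathrm{K}_n$ be the free monoid generated by the elements of $K_n$, modulo the single relation $s_0^n(e)=1$; the face and degeneracy operators of $\mathrm{F}^+\mathrm{K}$ are the unique monoid homomorphisms extending those of $K$. The identity element of every $\mathrm{F}^+\mathrm{K}_n$ is denoted $e$. For $n\ge 1$ and $1\le k\le n$ set $\alpha_k^{(n)}=s_0^{\,n-k}s_1^{\,k-1}y$ (so $\alpha_1^{(1)}=y$). Then $\mathrm{F}^+\mathrm{K}_0$ is trivial, and for $n\ge1$, $\mathrm{F}^+\mathrm{K}_n$ is the free monoid on $\alpha_1^{(n)},\dots,\alpha_n^{(n)}$. The faces, for $n\ge 2$, are $d_i(\alpha_k^{(n)})=\alpha_k^{(n-1)}$ for $0\le i\le n-k$ and $d_i(\alpha_k^{(n)})=\alpha_{k-1}^{(n-1)}$ for $n-k+1\le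 i\le n$, where $\alpha_0^{(n-1)}$ and $\alpha_n^{(n-1)}$ are to be read as $e$; also $d_0y=d_1y=e$. The word length of a simplex is its length as a word in the generators. For $k=2$ the product $\alpha_k^{(k)}\cdots\alpha_3^{(k)}$ is empty. **Order.** Order the generators of $\mathrm{F}^+\mathrm{K}_n$ by $\alpha_1^{(n)}<\dots<\alpha_n^{(n)}$, order words of the same length $\ell$ lexicographically, and declare words of length $\ell$ smaller than words of length $\ell+1$. **Restricted steepness pairing.** An $n$-simplex $\sigma$ is a regular face of an $(n+1)$-simplex $\tau$ if $\sigma=d_i\tau$ for exactly one index $i$. The restricted steepness pairing is the set of pairs $\{\sigma\prec\tau\}$, with $\sigma$ an $n$-simplex and $\tau$ an $(n+1)$-simplex ($n\ge0$), both nondegenerate and of the same word length $\ell$, such that: (i) $\sigma$ is a regular face of $\tau$; (ii) every nondegenerate word-length-$\ell$ face $\alpha\ne\sigma$ of $\tau$ satisfies $\alpha<\sigma$; (iii) every nondegenerate $(n+1)$-simplex $\mu\neq\tau$ of word length $\ell$ having $\sigma$ as a face (regular or not) satisfies $\tau<\mu$. All simplices not in a pair, including all degenerate simplices, are called critical. *)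

(* Defs.v *)
From HB Require Import structures.
From mathcomp Require Import all_boot all_order zify.

Set Implicit Arguments.
Unset Strict Implicit.
Unset Printing Implicit Defensive.

(* The n-simplices of K (the simplicial circle): [None] is the iterated
   degeneracy s_0^n(e) of the base point, and [Some j] is alpha_(j+1)^(n),
   with 0 <= j < n. Indices of the ordinal are thus shifted by one; the
   1-simplex y is [Some ord0 : K 1]. *)
Definition K (n : nat) := option 'I_n.

(* alpha_k^(n); it is the base point when k = 0 or k > n, which covers the
   convention that alpha_0^(n) and alpha_(n+1)^(n) are read as e. *)
Definition alpha (n k : nat) : K n := if k is j.+1 then insub j else None.

(* d_i alpha_k^(n+1) is alpha_k^(n) if i <= (n+1) - k and alpha_(k-1)^(n)
   otherwise, where k = j + 1. *)
Definition Kface (n : nat) (i : 'I_n.+2) (x : K n.+1) : K n :=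
  if x is Some j then
    if i <= n.+1 - j.+1 then alpha n j.+1 else alpha n j
  else None.

(* Viewing alpha_k^(n) as the monotone map [n] -> [1] taking the value 1 at
   the last k vertices, s_i repeats the i-th vertex. *)
Definition Kdegen (n : nat) (i : 'I_n.+1) (x : K n) : K n.+1 :=
  if x is Some j then
    if i <= n - j.+1 then alpha n.+1 j.+1 else alpha n.+1 j.+2
  else None.

(* The free monoid on K_n modulo s_0^n(e) = 1, i.e., the free monoid on
   alpha_1^(n), ..., alpha_n^(n): the product is concatenation, the identity is
   [::], and the word length is [size]. *)
Definition FK (n : nat) := seq 'I_n.

(* The canonical map K_n -> F^+K_n. *)
Definition gen (n : nat) (x : K n) : FK n := if x is Some j then [:: j] else [::].

(* [pmap] drops the letters that are sent to the base point. *)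
Definition face (n : nat) (i : 'I_n.+2) (w : FK n.+1) : FK n :=
  pmap (fun j => Kface i (Some j)) w.

Definition degen (n : nat) (i : 'I_n.+1) (w : FK n) : FK n.+1 :=
  pmap (fun j => Kdegen i (Some j)) w.

Definition degenerate (n : nat) : FK n -> Prop :=
  if n is m.+1 return FK n -> Prop
  then fun w => exists (i : 'I_m.+1) (v : FK m), w = degen i v
  else fun=> False.

Definition word_lt (n : nat) (u v : FK n) : Prop :=
  size u < size v \/
  size u = size v /\ (u < v :> seqlexi 'I_n)%O.

Definition is_face (n : nat) (s : FK n) (t : FK n.+1) : Prop :=
  exists i : 'I_n.+2, face i t = s.

Definition regular_face (n : nat) (s : FK n) (t : FK n.+1) : Prop :=
  exists! i : 'I_n.+2, face i t = s.

Definition steep_pair (n : nat) (s : FK n) (t : FK n.+1) : Prop :=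
  [/\ ~ degenerate s, ~ degenerate t & size s = size t] /\
  [/\ regular_face s t,
      forall a : FK n, is_face a t -> ~ degenerate a -> size a = size t ->
        a <> s -> word_lt a s
    & forall m : FK n.+1, is_face s m -> ~ degenerate m -> size m = size t ->
        m <> t -> word_lt t m].

Definition critical (n : nat) (w : FK n) : Prop :=
  (forall t : FK n.+1, ~ steep_pair w t) /\
  (if n is m.+1 return FK n -> Prop
   then fun w => forall s : FK m, ~ steep_pair s w
   else fun=> True) w.

(* The product alpha_(k_1)^(n) ... alpha_(k_r)^(n) for ks = [:: k_1; ...; k_r]. *)
Definition alpha_prod (n : nat) (ks : seq nat) : FK n :=
  flatten [seq gen (alpha n k) | k <- ks].

Definition sigma (k : nat) : FK k :=
  match k return FK k with
  | 0 => [::]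
  | 1 => gen (alpha 1 1)
  | _.+2 as n => alpha_prod n (rev (iota 1 n))
  end.

Definition tau (k : nat) : FK k :=
  match k return FK k with
  | 0 => [::]
  | 1 => gen (alpha 1 1)
  | _.+2 as n => alpha_prod n (rev (iota 3 (n - 2)) ++ [:: 2; 2])
  end.

(* Consistency of the encoding: alpha_k^(n) = s_0^(n-k) s_1^(k-1) y. *)
Lemma alpha_y : alpha 1 1 = Some ord0.
Proof. by rewrite /= insubT; congr Some; apply: val_inj. Qed.

Lemma alpha_s1 (k : nat) : 0 < k ->
  alpha k.+1 k.+1 = Kdegen (inord 1) (alpha k k).
Proof.
case: k => // k _; rewrite /= (insubT (fun j => j < k.+1) (ltnSn k)) /=.
by rewrite inordK // subnn.
Qed.

Lemma alpha_s0 (n k : nat) : 0 < k <= n ->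
  alpha n.+1 k = Kdegen ord0 (alpha n k).
Proof.
by case: k => //= k lt_kn; rewrite (insubT (fun j => j < n) lt_kn).
Qed.

Definition Kval (n : nat) (x : K n) : nat := if x is Some j then j.+1 else 0.

Lemma Kval_inj (n : nat) : injective (@Kval n).
Proof. by case=> [i|] [j|] //= [] /val_inj ->. Qed.

Lemma Kval_alpha (n k : nat) : Kval (alpha n k) = if k <= n then k else 0.
Proof. by case: k => //= k; case: insubP => [u -> <-|/negbTE ->]. Qed.

Lemma Kval_le (n : nat) (x : K n) : Kval x <= n.
Proof. by case: x => [j|] //=. Qed.

Lemma Kval_face (n : nat) (i : 'I_n.+2) (x : K n.+1) :
  Kval (Kface i x) =
    if i + Kval x <= n.+1 then (if Kval x <= n then Kval x else 0)
    else (Kval x).-1.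
Proof.
case: x => [j|]; last by rewrite /=; case: ifP.
rewrite /Kface (fun_if (@Kval n)) !Kval_alpha [Kval (Some j)]/=.
have := ltn_ord j; have := ltn_ord i.
by repeat case: ifP; lia.
Qed.

Lemma Kval_degen (n : nat) (i : 'I_n.+1) (x : K n) :
  Kval (Kdegen i x) =
    if (Kval x == 0) || (i + Kval x <= n) then Kval x else (Kval x).+1.
Proof.
case: x => [j|] //.
rewrite /Kdegen (fun_if (@Kval n.+1)) !Kval_alpha [Kval (Some j)]/=.
have := ltn_ord j; have := ltn_ord i.
by repeat case: ifP; lia.
Qed.

(* The simplicial identities; [inord] only changes the type of an index. *)
Local Ltac simplicial_id i j x :=
  move: (Kval_le x) (ltn_ord i) (ltn_ord j) => *;
  apply: Kval_inj; rewrite !(Kval_face, Kval_degen) ?inordK; try lia;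
  repeat case: ifP => //; lia.

Lemma Kface_face (n : nat) (i j : 'I_n.+3) (x : K n.+2) : i < j ->
  Kface (inord i) (Kface j x) = Kface (inord j.-1) (Kface i x).
Proof. simplicial_id i j x. Qed.

Lemma Kdegen_degen (n : nat) (i j : 'I_n.+1) (x : K n) : i <= j ->
  Kdegen (inord i) (Kdegen j x) = Kdegen (inord j.+1) (Kdegen i x).
Proof. simplicial_id i j x. Qed.

Lemma Kface_degen_lt (n : nat) (i j : 'I_n.+2) (x : K n.+1) : i < j ->
  Kface (inord i) (Kdegen j x) = Kdegen (inord j.-1) (Kface i x).
Proof. simplicial_id i j x. Qed.

Lemma Kface_degen_id (n : nat) (i : 'I_n.+2) (j : 'I_n.+1) (x : K n) :
  j <= i <= j.+1 -> Kface i (Kdegen j x) = x.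
Proof. simplicial_id i j x. Qed.

Lemma Kface_degen_gt (n : nat) (i : 'I_n.+3) (j : 'I_n.+2) (x : K n.+1) :
  j.+1 < i -> Kface i (Kdegen j x) = Kdegen (inord j) (Kface (inord i.-1) x).
Proof. simplicial_id i j x. Qed.

Lemma face_gen (n : nat) (i : 'I_n.+2) (x : K n.+1) :
  face i (gen x) = gen (Kface i x).
Proof. by case: x => [j|] //; rewrite /face [pmap _ _]/=; case: (Kface i _). Qed.

Lemma degen_gen (n : nat) (i : 'I_n.+1) (x : K n) :
  degen i (gen x) = gen (Kdegen i x).
Proof. by case: x => [j|] //; rewrite /degen [pmap _ _]/=; case: (Kdegen i _). Qed.

(* Main.v *)
Require Import Defs.
From mathcomp Require Import all_boot all_order.
From mathcomp Require Import perm zify.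

(** A simplex of dimension [n] is nondegenerate exactly when every generator
    [alpha_1, ..., alpha_n] occurs in it, because a degeneracy renumbers the
    generators so as to skip one of them. This settles [tau_k] for [k >= 2]:
    it does not involve [alpha_1], hence it is degenerate.

    The word [sigma_k] uses each of the [k] generators once. A partner of higher
    dimension would be a nondegenerate word of length [k] using [k + 1]
    generators, so there is none. A partner [s] of lower dimension is a face of
    the same length; such a face identifies two consecutive generators [p] and
    [p + 1]. Exchanging [p] and [p + 1] in [sigma_k] produces another
    nondegenerate word of length [k] with the face [s]. As [sigma_k] is
    decreasing, it is lexicographically greater than all its rearrangements
    ([lexi_le_sorted_perm]), in particular than that word; so it is not the
    least coface of [s], contrary to condition (iii) of the pairing. *)

Set Implicit Arguments.
Unset Strict Implicit.
Unset Printing Implicit Defensive.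

Import Order.TTheory.

(** The first letter of a decreasing word is the largest letter available, so
    a rearrangement is already smaller there or agrees with it there. *)
Lemma lexi_le_sorted_perm (d : Order.disp_t) (T : orderType d) (s t : seq T) :
  sorted >=%O s -> perm_eq t s -> (t <= s :> seqlexi T)%O.
Proof.
elim: s t => [|x s IHs] [|y t] //; first by move=> _ /perm_size.
move=> s_sorted t_perm; rewrite lexi_cons.
have le_yx : (y <= x)%O.
  have : y \in x :: s by rewrite -(perm_mem t_perm) mem_head.
  rewrite inE => /predU1P [-> // | y_s].
  by have /allP/(_ y y_s) := order_path_min ge_trans s_sorted.
rewrite le_yx /=; apply/implyP => le_xy.
have eq_yx : y = x by apply/le_anti/andP.
apply: IHs; first exact: path_sorted s_sorted.
by rewrite -(perm_cons x) -{1}eq_yx.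
Qed.

Lemma notin_degen (n : nat) (i : 'I_n.+1) (v : FK n) :
  inord (n - i) \notin degen i v.
Proof.
rewrite mem_pmap; apply/mapP => -[j _] /(congr1 (@Kval _)).
rewrite Kval_degen /= inordK; last by lia.
by have := ltn_ord i; case: ifP; lia.
Qed.

(** The degeneracy that skips a generator [p] is undone, on words without [p],
    by the face that identifies [p] with the next generator (or that drops [p]
    if it is the last one). *)
Lemma degen_face (n : nat) (p : 'I_n.+1) (w : FK n.+1) : p \notin w ->
  degen (rev_ord p) (face (widen_ord (leqnSn n.+1) (rev_ord p)) w) = w.
Proof.
elim: w => // j w IHw; rewrite inE negb_or => /andP [ne_pj /IHw {}IHw].
rewrite -cat1s -[[:: j]]/(gen (Some j)) /face /degen !pmap_cat.
congr (_ ++ _); last exact: IHw.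
rewrite -/(face _ _) -/(degen _ _) face_gen degen_gen; congr gen.
apply: Kval_inj; rewrite Kval_degen Kval_face /=.
have := ltn_ord p; have := ltn_ord j.
by move: ne_pj; rewrite -val_eqE /=; repeat case: ifP; lia.
Qed.

Lemma nondegenerateP (n : nat) (w : FK n) :
  ~ degenerate w <-> forall p : 'I_n, p \in w.
Proof.
case: n w => [|n] w; first by split=> // _ [].
split=> [w_nondeg p | w_full [i [v w_def]]].
  apply/negPn/negP => p_notin_w; apply: w_nondeg.
  by exists (rev_ord p), (face (widen_ord (leqnSn n.+1) (rev_ord p)) w);
     rewrite degen_face.
by have := notin_degen i v; rewrite -w_def w_full.
Qed.

Lemma nondegenerate_size (n : nat) (w : FK n) : ~ degenerate w -> n <= size w.
Proof.
move=> /nondegenerateP w_full; rewrite -[X in X <= _](size_enum_ord n).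
by apply: uniq_leq_size => [|p _]; rewrite ?enum_uniq.
Qed.

Lemma degenerate_critical (n : nat) (w : FK n) : degenerate w -> critical w.
Proof.
move=> w_deg; split=> [t [[]] //|].
by case: n w w_deg => // n w w_deg s [[]].
Qed.

(** A word length is kept by a face only if no generator is dropped; on a
    nondegenerate word this excludes the two outer faces. *)
Lemma face_size_inner (n : nat) (i : 'I_n.+2) (w : FK n.+1) :
  ~ degenerate w -> size (face i w) = size w -> 0 < i < n.+1.
Proof.
move=> /nondegenerateP w_full; rewrite size_pmap => /eqP.
rewrite -all_count => /allP kept.
have Kval_kept j : 0 < Kval (Kface i (Some j)).
  by have := kept j (w_full j); rewrite -/(Kface i (Some j)); case: (Kface _ _).
have := Kval_kept ord0; have := Kval_kept ord_max.
by rewrite !Kval_face /=; have := ltn_ord i; repeat case: ifP; lia.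
Qed.

Lemma inner_face_identifies (n : nat) (i : 'I_n.+2) : 0 < i < n.+1 ->
  exists p q : 'I_n.+1, p <> q /\ Kface i (Some p) = Kface i (Some q).
Proof.
move=> i_inner; exists (inord (n - i)), (inord (n.+1 - i)); split.
  by move=> /(congr1 val); rewrite /= !inordK; lia.
apply: Kval_inj; rewrite !Kval_face /= !inordK; try lia.
by repeat case: ifP; lia.
Qed.

Lemma face_map (n : nat) (i : 'I_n.+2) (f : 'I_n.+1 -> 'I_n.+1) (w : FK n.+1) :
  (forall j, Kface i (Some (f j)) = Kface i (Some j)) ->
  face i [seq f j | j <- w] = face i w.
Proof.
by move=> fP; rewrite /face; elim: w => //= j w ->; rewrite -!/(Kface i (Some _)) fP.
Qed.

(** All generators occurring once is what makes a coface of the same length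
    degenerate; decreasing order is what makes the exchange of two identified
    generators produce a smaller coface of the same face. *)
Lemma decreasing_critical (n : nat) (w : FK n) :
  (forall p : 'I_n, p \in w) -> uniq w -> sorted >=%O w -> critical w.
Proof.
move=> w_full w_uniq w_sorted; split.
  (* [w] has too few letters for a nondegenerate coface of the same length. *)
  move=> t [[_ /nondegenerate_size t_size eq_size] _]; move: t_size.
  suff -> : size t = n by rewrite ltnn.
  rewrite -eq_size -[RHS](size_enum_ord n).
  by apply/perm_size/uniq_perm; rewrite ?enum_uniq // => p; rewrite mem_enum w_full.
case: n w w_full w_uniq w_sorted => // n w w_full w_uniq w_sorted s.
move=> [[_ w_nondeg eq_size] [[i [face_i _]] _ w_least]].
have [p [q [ne_pq eq_pq]]] : exists p q : 'I_n.+1,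
    p <> q /\ Kface i (Some p) = Kface i (Some q).
  by apply/inner_face_identifies/(face_size_inner w_nondeg); rewrite face_i.
(* The competing coface that violates the minimality of [w]. *)
pose m : FK n.+1 := [seq tperm p q j | j <- w].
have m_full j : j \in m by rewrite -[j](tpermK p q) map_f.
have m_face : face i m = s.
  by rewrite -face_i; apply: face_map => j; case: tpermP => // ->.
have ne_mw : m <> w.
  rewrite -[RHS]map_id => /eq_in_map/(_ p (w_full p)).
  by rewrite tpermL => /esym.
have m_perm : perm_eq m w.
  by apply: uniq_perm => // [|j]; rewrite ?(map_inj_uniq perm_inj) ?m_full ?w_full.
have m_size : size m = size w by rewrite size_map.
case: (w_least m (ex_intro _ i m_face) _ m_size ne_mw) => [||[_]].
- exact/nondegenerateP.
- by rewrite m_size ltnn.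
by rewrite ltNge lexi_le_sorted_perm.
Qed.

(** Back to the numbering of the generators from 1; the filter accounts for the
    indices that [alpha] reads as the base point. *)
Lemma alpha_prod_indices (n : nat) (ks : seq nat) :
  [seq j.+1 | j : 'I_n <- alpha_prod n ks] = [seq k <- ks | 0 < k <= n].
Proof.
rewrite /alpha_prod; elim: ks => //= k ks IHks; rewrite map_cat IHks.
by case: k => //= k; case: insubP => [j -> <- | /negbTE ->].
Qed.

Lemma mem_alpha_prod (n : nat) (ks : seq nat) (j : 'I_n) :
  (j \in alpha_prod n ks) = (j.+1 \in ks).
Proof.
have succ_inj : injective (fun j : 'I_n => j.+1).
  by move=> j1 j2 [] /val_inj.
by rewrite -(mem_map succ_inj) alpha_prod_indices mem_filter /= ltn_ord.
Qed.

Lemma sigmaE (k : nat) : sigma k = alpha_prod k (rev (iota 1 k)).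
Proof. by case: k => [|[|k]] //; rewrite /alpha_prod [RHS]/= cats0. Qed.

Lemma sigma_critical (k : nat) : critical (sigma k).
Proof.
rewrite sigmaE; set w := alpha_prod _ _.
have w_indices : [seq j.+1 | j : 'I_k <- w] = rev (iota 1 k).
  rewrite alpha_prod_indices; apply/all_filterP/allP => j.
  by rewrite mem_rev mem_iota; lia.
apply: decreasing_critical => [p||].
- by rewrite mem_alpha_prod mem_rev mem_iota; have := ltn_ord p; lia.
- by apply: (@map_uniq _ _ (fun j : 'I_k => j.+1));
     rewrite w_indices rev_uniq iota_uniq.
have : sorted geq [seq j.+1 | j : 'I_k <- w].
  by rewrite w_indices rev_sorted iota_sorted.
by rewrite sorted_map.
Qed.

Lemma tau_critical (k : nat) : critical (tau k).
Proof.
case: k => [|[|k]]; [exact: sigma_critical 0 | exact: sigma_critical 1 |].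
apply: degenerate_critical; rewrite /tau.
exists (rev_ord ord0), (face (widen_ord (leqnSn k.+2) (rev_ord ord0)) (tau k.+2)).
by rewrite degen_face // mem_alpha_prod mem_cat mem_rev mem_iota.
Qed.

Theorem theorem5p1 : forall k : nat, critical (sigma k) /\ critical (tau k).
Proof. by move=> k; split; [apply: sigma_critical | apply: tau_critical]. Qed.
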